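(* Let $q$ be a prime power such that $3$ is not a square in $\mathbb{F}_q$. Then the set $$\{(1,t,t^2,t^3,t^4)\mid t\in \mathbb{F}_q\} \cup \{(0,1,2t,3t^2,4t^3) \mid t\in \mathbb{F}_q\} \cup \{(0,0,0,0,1)\}\subseteq \mathbb{P}^4(\mathbb{F}_q)$$ is a track of size $2q+1$.
   Context: Points of $\mathbb{P}^4(\mathbb{F}_q)$ are written in homogeneous coordinates $(x_0,x_1,x_2,x_3,x_4)$. A track in $\mathbb{P}^4(\mathbb{F}_q)$ is a set of points no four distinct of which lie on a common plane (a $2$-dimensional projective subspace). *)

(* Defs.v *)
From HB Require Import structures.
From mathcomp Require Import all_boot all_order all_algebra.

Set Implicit Arguments.
Unset Strict Implicit.
Unset Printing Implicit Defensive.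

Import GRing.Theory.
Local Open Scope ring_scope.

(* Over a finite field the subspaces of a vector space form a finite type
   (they are encoded by square matrices), so {set _} and #|_| apply to sets of
   subspaces and to sets of projective points. *)
Section FiniteVspace.
Import VectorInternalTheory.
Variables (F : finFieldType) (vT : vectType F).
HB.instance Definition _ := [Countable of {vspace vT} by <:].
HB.instance Definition _ := [Finite of {vspace vT} by <:].
End FiniteVspace.

(* P^n(F): the 1-dimensional linear subspaces of F^(n+1) *)
Definition proj_space (F : finFieldType) (n : nat) :=
  {L : {vspace 'rV[F]_n.+1} | \dim L == 1%N}.

HB.instance Definition _ (F : finFieldType) (n : nat) :=
  SubFinite.on (proj_space F n).

Section Projective.

Variables (F : finFieldType) (n : nat).

Definition point_line (P : proj_space F n) : {vspace 'rV[F]_n.+1} := val P.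

(* This forces v != 0, because point_line P has dimension 1. *)
Definition has_hcoords (P : proj_space F n) (v : 'rV[F]_n.+1) : bool :=
  point_line P == <[v]>%VS.

(* A k-dimensional projective subspace is a linear subspace of dimension k+1. *)
Definition is_proj_subspace (k : nat) (W : {vspace 'rV[F]_n.+1}) : bool :=
  \dim W == k.+1.

Definition lies_on (P : proj_space F n) (W : {vspace 'rV[F]_n.+1}) : bool :=
  (point_line P <= W)%VS.

Lemma has_hcoords_neq0 (P : proj_space F n) (v : 'rV[F]_n.+1) :
  has_hcoords P v -> v != 0.
Proof.
move=> /eqP Pv; have := valP P.
by rewrite -/(point_line P) Pv dim_vline; case: (v != 0).
Qed.

Lemma hcoords_exists (v : 'rV[F]_n.+1) :
  v != 0 -> exists! P : proj_space F n, has_hcoords P v.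
Proof.
move=> v0; have d1 : \dim <[v]>%VS == 1%N by rewrite dim_vline v0.
exists (exist _ <[v]>%VS d1); split; first exact: eqxx.
by move=> P /eqP Pv; apply: val_inj.
Qed.

End Projective.

Definition is_track (F : finFieldType) (S : {set proj_space F 4}) : Prop :=
  forall A : {set proj_space F 4}, A \subset S -> #|A| = 4%N ->
  ~ exists W : {vspace 'rV[F]_5},
      is_proj_subspace 2 W /\ (forall P, P \in A -> lies_on P W).

Definition coords5 (F : finFieldType) (x0 x1 x2 x3 x4 : F) : 'rV[F]_5 :=
  \row_(i < 5) [:: x0; x1; x2; x3; x4]`_i.

(* Main.v *)
Require Import Defs.
From mathcomp Require Import all_boot all_order all_algebra.
From mathcomp Require Import ring.
Import GRing.Theory.
Local Open Scope ring_scope.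

(** Four distinct points of the set span a 4-dimensional space. Call c(t) the
points of the rational normal curve and d(t) = c'(t). A linear relation
between such points is a functional f |-> sum alpha f(a) + sum beta f'(s)
+ epsilon f_4 vanishing on polynomials of degree at most 4; testing it on powers
of X - m, for a suitable m, gives simple equations. When the relation does not
reduce to a Vandermonde system, m is the midpoint of a and b for two points
c(a), c(b), and the point s for c(a), c(b), c(c), d(s). The only obstruction is
for c(m + h), c(m - h), d(m + s), d(m - s), where it reads h^2 = 3 s^2. That 3
is not a square also excludes characteristics 2 and 3. *)

(** * Homogeneous linear systems over a field *)

Section LinearRelations.

Context {F : fieldType}.
Implicit Types (a b c d e h s t u x y k : F).

(** Each elimination below is given by its multipliers [c0], [c1], ...; what remains is a polynomial
    identity for [ring]. The multipliers are the coefficients of the polynomial on which the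
    relation is tested, possibly followed by corrections. *)
Lemma lincomb5_eq0 c0 c1 c2 c3 c4 {e0 e1 e2 e3 e4 x} :
  e0 = 0 -> e1 = 0 -> e2 = 0 -> e3 = 0 -> e4 = 0 ->
  x = c0 * e0 + c1 * e1 + c2 * e2 + c3 * e3 + c4 * e4 -> x = 0.
Proof. by move=> -> -> -> -> -> ->; rewrite !mulr0 !addr0. Qed.

Lemma lincomb4_eq0 c0 c1 c2 c3 {e0 e1 e2 e3 x} :
  e0 = 0 -> e1 = 0 -> e2 = 0 -> e3 = 0 ->
  x = c0 * e0 + c1 * e1 + c2 * e2 + c3 * e3 -> x = 0.
Proof. by move=> -> -> -> -> ->; rewrite !mulr0 !addr0. Qed.

Lemma lincomb3_eq0 c0 c1 c2 {e0 e1 e2 x} :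
  e0 = 0 -> e1 = 0 -> e2 = 0 -> x = c0 * e0 + c1 * e1 + c2 * e2 -> x = 0.
Proof. by move=> -> -> -> ->; rewrite !mulr0 !addr0. Qed.

Lemma lincomb2_eq0 c0 c1 {e0 e1 x} :
  e0 = 0 -> e1 = 0 -> x = c0 * e0 + c1 * e1 -> x = 0.
Proof. by move=> -> -> ->; rewrite !mulr0 !addr0. Qed.

Lemma mulIf_eq0 {k x} : k != 0 -> x * k = 0 -> x = 0.
Proof. by move=> /negPf k0 /eqP; rewrite mulf_eq0 k0 orbF => /eqP. Qed.

Lemma vandermonde2_eq0 {k1 k2 a b} :
  a != b -> k1 + k2 = 0 -> k1 * a + k2 * b = 0 -> k1 = 0 /\ k2 = 0.
Proof.
move=> ab E0 E1; have {}ab : a - b != 0 by rewrite subr_eq0.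
split; apply: (mulIf_eq0 ab).
  by apply: (lincomb2_eq0 (- b) 1 E0 E1); ring.
by apply: (lincomb2_eq0 a (- 1) E0 E1); ring.
Qed.

(** Tested on (X - b)(X - c), the relation keeps only its first term. *)
Lemma vandermonde3_eq0 {k1 k2 k3 a b c} :
  a != b -> a != c -> b != c ->
  k1 + k2 + k3 = 0 -> k1 * a + k2 * b + k3 * c = 0 ->
  k1 * a ^+ 2 + k2 * b ^+ 2 + k3 * c ^+ 2 = 0 ->
  [/\ k1 = 0, k2 = 0 & k3 = 0].
Proof.
move=> ab ac bc E0 E1 E2.
have k10 : k1 = 0.
  have p0 : (a - b) * (a - c) != 0 by rewrite mulf_neq0 ?subr_eq0.
  apply: (mulIf_eq0 p0).
  by apply: (lincomb3_eq0 (b * c) (- (b + c)) 1 E0 E1 E2); ring.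
move: E0 E1; rewrite k10 mul0r !add0r => E0 E1.
by have [] := vandermonde2_eq0 bc E0 E1.
Qed.

Lemma vandermonde4_eq0 {k1 k2 k3 k4 a b c d} :
  uniq [:: a; b; c; d] ->
  k1 + k2 + k3 + k4 = 0 -> k1 * a + k2 * b + k3 * c + k4 * d = 0 ->
  k1 * a ^+ 2 + k2 * b ^+ 2 + k3 * c ^+ 2 + k4 * d ^+ 2 = 0 ->
  k1 * a ^+ 3 + k2 * b ^+ 3 + k3 * c ^+ 3 + k4 * d ^+ 3 = 0 ->
  [/\ k1 = 0, k2 = 0, k3 = 0 & k4 = 0].
Proof.
rewrite /= !inE !negb_or andbT.
move=> /and3P[/and3P[ab ac ad] /andP[bc bd] cd] E0 E1 E2 E3.
have k10 : k1 = 0.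
  have p0 : (a - b) * (a - c) * (a - d) != 0 by rewrite !mulf_neq0 ?subr_eq0.
  apply: (mulIf_eq0 p0).
  (* The coefficients of (X - b)(X - c)(X - d), constant term first. *)
  apply: (lincomb4_eq0 (- (b * c * d)) (b * c + b * d + c * d) (- (b + c + d)) 1
            E0 E1 E2 E3).
  by ring.
move: E0 E1 E2; rewrite k10 !mul0r !add0r => E0 E1 E2.
by have [] := vandermonde3_eq0 bc bd cd E0 E1 E2.
Qed.

(** * Systems in which the equation of order 1 is missing *)

Hypotheses (two_neq0 : 2%:R != 0 :> F) (three_neq0 : 3%:R != 0 :> F).

(** The polynomial X^2 - a^2 kills [a] and [- a] and isolates [k3]; then X^3 + a^3 separates [a]
    from [- a]. *)
Lemma opposite_relation3_eq0 {k1 k2 k3 a c} :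
  a != - a -> a != c -> - a != c ->
  k1 + k2 + k3 = 0 ->
  k1 * a ^+ 2 + k2 * (- a) ^+ 2 + k3 * c ^+ 2 = 0 ->
  k1 * a ^+ 3 + k2 * (- a) ^+ 3 + k3 * c ^+ 3 = 0 ->
  [/\ k1 = 0, k2 = 0 & k3 = 0].
Proof.
move=> aNa ac Nac E0 E2 E3.
have k30 : k3 = 0.
  have p0 : (a - c) * (- a - c) != 0 by rewrite mulf_neq0 ?subr_eq0.
  by apply: (mulIf_eq0 p0); apply: (lincomb2_eq0 (- a ^+ 2) 1 E0 E2); ring.
move: E0 E3; rewrite k30 mul0r !addr0 => E0 E3.
have a0 : a != 0 by apply: contraNneq aNa => ->; rewrite oppr0.
have k10 : k1 = 0.
  have p0 : 2%:R * a ^+ 3 != 0 by rewrite mulf_neq0 ?expf_neq0.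
  by apply: (mulIf_eq0 p0); apply: (lincomb2_eq0 (a ^+ 3) 1 E0 E3); ring.
by split=> //; move: E0; rewrite k10 add0r.
Qed.

(** Orders 0, 2 and 4 form a Vandermonde system in the squares, which settles the case of distinct
    squares. If two squares agree, the numbers are opposite and order 3 tells them apart. *)
Lemma lacunary_relation3_eq0 {k1 k2 k3 a b c} :
  a != b -> a != c -> b != c ->
  k1 + k2 + k3 = 0 ->
  k1 * a ^+ 2 + k2 * b ^+ 2 + k3 * c ^+ 2 = 0 ->
  k1 * a ^+ 3 + k2 * b ^+ 3 + k3 * c ^+ 3 = 0 ->
  k1 * a ^+ 4 + k2 * b ^+ 4 + k3 * c ^+ 4 = 0 ->
  [/\ k1 = 0, k2 = 0 & k3 = 0].
Proof.
move=> ab ac bc E0 E2 E3 E4.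
have [Dsq|sq_ab] := eqVneq (a ^+ 2) (b ^+ 2).
  have {Dsq} Db : b = - a.
    by move/eqP: Dsq; rewrite eqf_sqr (negPf ab) => /eqP->; rewrite opprK.
  by rewrite Db in ab bc E2 E3; apply: (opposite_relation3_eq0 ab ac bc).
have [Dsq|sq_ac] := eqVneq (a ^+ 2) (c ^+ 2).
  have {Dsq} Dc : c = - a.
    by move/eqP: Dsq; rewrite eqf_sqr (negPf ac) => /eqP->; rewrite opprK.
  rewrite Dc in ac bc E2 E3; rewrite eq_sym in bc.
  by case: (opposite_relation3_eq0 (k1 := k1) (k2 := k3) (k3 := k2) ac ab bc);
    rewrite // addrAC.
have [Dsq|sq_bc] := eqVneq (b ^+ 2) (c ^+ 2).
  have {Dsq} Dc : c = - b.
    by move/eqP: Dsq; rewrite eqf_sqr (negPf bc) => /eqP->; rewrite opprK.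
  rewrite Dc in ac bc E2 E3; rewrite eq_sym in ab; rewrite eq_sym in ac.
  by case: (opposite_relation3_eq0 (k1 := k2) (k2 := k3) (k3 := k1) bc ab ac);
    rewrite // -addrC addrA.
by apply: (vandermonde3_eq0 sq_ab sq_ac sq_bc E0 E2); rewrite -!exprM.
Qed.

Lemma midpoint a b : exists m h, a = m + h /\ b = m - h.
Proof. by exists ((a + b) / 2%:R), ((a - b) / 2%:R); split; field. Qed.

Lemma free_row4 {n} {v1 v2 v3 v4 : 'rV[F]_n} :
  (forall k1 k2 k3 k4,
     (forall j, k1 * v1 0 j + k2 * v2 0 j + k3 * v3 0 j + k4 * v4 0 j = 0) ->
     [/\ k1 = 0, k2 = 0, k3 = 0 & k4 = 0]) ->
  free [:: v1; v2; v3; v4].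
Proof.
move=> indep; apply/(@freeP _ _ _ [tuple v1; v2; v3; v4]) => k.
rewrite !big_ord_recl big_ord0 addr0 /= => Ek.
have [] := indep (k ord0) (k (lift ord0 ord0)) (k (lift ord0 (lift ord0 ord0)))
             (k (lift ord0 (lift ord0 (lift ord0 ord0)))).
  by move=> j; have /rowP/(_ j) := Ek; rewrite !mxE !addrA.
move=> z0 z1 z2 z3 i.
by case: i => [[|[|[|[|//]]]] lti]; [rewrite -[RHS]z0|rewrite -[RHS]z1
  |rewrite -[RHS]z2|rewrite -[RHS]z3]; congr (k _); apply: val_inj.
Qed.

End LinearRelations.

(** * Coordinate vectors of the points *)

Section TrackPoints.

Variable F : finFieldType.
Implicit Types (a b c d s t u : F).

Definition curve_vec t : 'rV[F]_5 := coords5 1 t (t ^+ 2) (t ^+ 3) (t ^+ 4).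

Definition tangent_vec t : 'rV[F]_5 :=
  coords5 0 1 (2%:R * t) (3%:R * t ^+ 2) (4%:R * t ^+ 3).

Definition infty_vec : 'rV[F]_5 := coords5 0 0 0 0 1.

(** The index type has [2 * q + 1] elements, so the size of the track will follow from
    injectivity. *)
Definition track_vec (i : option (F + F)) : 'rV[F]_5 :=
  match i with
  | Some (inl t) => curve_vec t
  | Some (inr t) => tangent_vec t
  | None => infty_vec
  end.

Lemma free_coords5 x0 x1 x2 x3 x4 y0 y1 y2 y3 y4
    z0 z1 z2 z3 z4 w0 w1 w2 w3 w4 :
  (forall k1 k2 k3 k4 : F,
     k1 * x0 + k2 * y0 + k3 * z0 + k4 * w0 = 0 ->
     k1 * x1 + k2 * y1 + k3 * z1 + k4 * w1 = 0 ->
     k1 * x2 + k2 * y2 + k3 * z2 + k4 * w2 = 0 ->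
     k1 * x3 + k2 * y3 + k3 * z3 + k4 * w3 = 0 ->
     k1 * x4 + k2 * y4 + k3 * z4 + k4 * w4 = 0 ->
     [/\ k1 = 0, k2 = 0, k3 = 0 & k4 = 0]) ->
  free [:: coords5 x0 x1 x2 x3 x4; coords5 y0 y1 y2 y3 y4;
           coords5 z0 z1 z2 z3 z4; coords5 w0 w1 w2 w3 w4].
Proof.
move=> indep; apply: free_row4 => k1 k2 k3 k4 E.
have E0 := E (@Ordinal 5 0 isT); have E1 := E (@Ordinal 5 1 isT).
have E2 := E (@Ordinal 5 2 isT); have E3 := E (@Ordinal 5 3 isT).
have E4 := E (@Ordinal 5 4 isT).
rewrite !mxE /= in E0 E1 E2 E3 E4.
exact: indep.
Qed.

(** * Integers that are invertible because 3 is not a square *)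

Hypothesis three_nonsquare : ~ exists x : F, x ^+ 2 = 3%:R.

Lemma two_neq0 : 2%:R != 0 :> F.
Proof.
apply/eqP => two0; apply: three_nonsquare; exists 1.
(* In characteristic 2, 3 = 1 is the square of 1. *)
by rewrite expr1n -[3%N]/(2 + 1)%N natrD two0 add0r.
Qed.

Lemma three_neq0 : 3%:R != 0 :> F.
Proof.
by apply/eqP => three0; apply: three_nonsquare; exists 0; rewrite three0 expr0n.
Qed.

Lemma four_neq0 : 4%:R != 0 :> F.
Proof. by rewrite -[4%N]/(2 * 2)%N natrM mulf_neq0 ?two_neq0. Qed.

(** * Independence by type: [c] for curve, [d] for tangent, [e] for infinity *)

Lemma free_cccc a b c d : uniq [:: a; b; c; d] ->
  free [:: curve_vec a; curve_vec b; curve_vec c; curve_vec d].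
Proof.
move=> Us; apply: free_coords5 => k1 k2 k3 k4; rewrite !mulr1 => E0 E1 E2 E3 _.
exact: vandermonde4_eq0 Us E0 E1 E2 E3.
Qed.

Lemma uniq3 {a b c} : uniq [:: a; b; c] -> [/\ a != b, a != c & b != c].
Proof. by rewrite /= !inE negb_or andbT => /andP[/andP[]]. Qed.

Lemma free_ccce a b c : uniq [:: a; b; c] ->
  free [:: curve_vec a; curve_vec b; curve_vec c; infty_vec].
Proof.
move=> /uniq3[ab ac bc]; apply: free_coords5 => k1 k2 k3 k4.
rewrite !mulr1 !mulr0 !addr0 => E0 E1 E2 _.
have [-> -> ->] := vandermonde3_eq0 ab ac bc E0 E1 E2.
by rewrite !mul0r !add0r.
Qed.

(** Once the factors 2, 3 and 4 are cancelled, the last four coordinates form a Vandermonde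
    system. *)
Lemma free_dddd a b c d : uniq [:: a; b; c; d] ->
  free [:: tangent_vec a; tangent_vec b; tangent_vec c; tangent_vec d].
Proof.
move=> Us; apply: free_coords5 => k1 k2 k3 k4 _; rewrite !mulr1 => E1 E2 E3 E4.
apply: (vandermonde4_eq0 Us E1).
- by apply: (mulIf_eq0 two_neq0); rewrite -[RHS]E2; ring.
- by apply: (mulIf_eq0 three_neq0); rewrite -[RHS]E3; ring.
- by apply: (mulIf_eq0 four_neq0); rewrite -[RHS]E4; ring.
Qed.

Lemma free_ddde a b c : uniq [:: a; b; c] ->
  free [:: tangent_vec a; tangent_vec b; tangent_vec c; infty_vec].
Proof.
move=> /uniq3[ab ac bc]; apply: free_coords5 => k1 k2 k3 k4 _.
rewrite !mulr1 !mulr0 !addr0 => E1 E2 E3.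
have [||-> -> ->] := vandermonde3_eq0 ab ac bc E1.
- by apply: (mulIf_eq0 two_neq0); rewrite -[RHS]E2; ring.
- by apply: (mulIf_eq0 three_neq0); rewrite -[RHS]E3; ring.
by rewrite !mul0r !add0r.
Qed.

(** Tangent vectors have first coordinate 0, so the curve vector drops out at once. *)
Lemma free_cddd t a b c : uniq [:: a; b; c] ->
  free [:: curve_vec t; tangent_vec a; tangent_vec b; tangent_vec c].
Proof.
move=> /uniq3[ab ac bc]; apply: free_coords5 => k1 k2 k3 k4.
rewrite !mulr1 !mulr0 !addr0 => ->; rewrite !mul0r !add0r => E1 E2 E3 _.
have [||-> -> -> //] := vandermonde3_eq0 ab ac bc E1.
- by apply: (mulIf_eq0 two_neq0); rewrite -[RHS]E2; ring.
- by apply: (mulIf_eq0 three_neq0); rewrite -[RHS]E3; ring.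
Qed.

Lemma free_cdde t a b : a != b ->
  free [:: curve_vec t; tangent_vec a; tangent_vec b; infty_vec].
Proof.
move=> ab; apply: free_coords5 => k1 k2 k3 k4.
rewrite !mulr1 !mulr0 !addr0 => ->; rewrite !mul0r !add0r => E1 E2 _.
have [|-> ->] := vandermonde2_eq0 ab E1.
  by apply: (mulIf_eq0 two_neq0); rewrite -[RHS]E2; ring.
by rewrite !mul0r !add0r.
Qed.

Lemma free_cccd a b c s : uniq [:: a; b; c] ->
  free [:: curve_vec a; curve_vec b; curve_vec c; tangent_vec s].
Proof.
move=> /uniq3[ab ac bc]; apply: free_coords5 => k1 k2 k3 k4.
rewrite !mulr1 !mulr0 !addr0 => E0 E1 E2 E3 E4.
have subs x y : x != y -> x - s != y - s.
  by apply: contra_neq => /addIr.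
(* The derivative of (X - s)^i vanishes at [s] for i = 0, 2, 3, 4, so testing on these powers
   removes the tangent vector. The multipliers below are their binomial coefficients. *)
have [||||z1 z2 z3] := lacunary_relation3_eq0 two_neq0
  (subs _ _ ab) (subs _ _ ac) (subs _ _ bc) (k1 := k1) (k2 := k2) (k3 := k3).
- exact: E0.
- by apply: (lincomb3_eq0 (s ^+ 2) (- 2%:R * s) 1 E0 E1 E2); ring.
- apply: (lincomb4_eq0 (- s ^+ 3) (3%:R * s ^+ 2) (- 3%:R * s) 1 E0 E1 E2 E3).
  by ring.
- apply: (lincomb5_eq0 (s ^+ 4) (- 4%:R * s ^+ 3) (6%:R * s ^+ 2) (- 4%:R * s) 1
            E0 E1 E2 E3 E4).
  by ring.
by split=> //; move: E1; rewrite z1 z2 z3 !mul0r !add0r.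
Qed.

Lemma free_ccde a b s : a != b ->
  free [:: curve_vec a; curve_vec b; tangent_vec s; infty_vec].
Proof.
have [m [h [-> ->]]] := midpoint two_neq0 a b.
have [s' ->] : exists s', s = m + s' by exists (s - m); rewrite addrC subrK.
move: s' => {}s ab; have h0 : h != 0.
  by apply: contraNneq ab => ->; rewrite subr0 addr0.
apply: free_coords5 => k1 k2 k3 k4.
rewrite !mulr1 !mulr0 !addr0 => E0 E1 E2 E3 E4.
have Dk2 : k2 = - k1 by apply/eqP; rewrite -addr_eq0 addrC E0.
have D3 : k3 = - (2%:R * k1 * h).
  by apply/eqP; rewrite -addr_eq0 -[X in _ == X]E1 Dk2; apply/eqP; ring.
(* Since [k2 = - k1], the curve terms cancel in even powers of X - m. Order 2 thus leaves only the
   tangent term 2 k3 s = -4 k1 h s. *)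
have k1s : k1 * s = 0.
  have p0 : - 4%:R * h != 0 by rewrite mulf_neq0 ?oppr_eq0 ?four_neq0.
  apply: (mulIf_eq0 p0).
  by apply: (lincomb3_eq0 (m ^+ 2 - h ^+ 2) (- 2%:R * m) 1 E0 E1 E2);
    rewrite Dk2 D3; ring.
have k10 : k1 = 0.
  have p0 : 2%:R * h ^+ 3 != 0 by rewrite mulf_neq0 ?expf_neq0 ?two_neq0.
  apply: (mulIf_eq0 p0).
  (* Order 3 reads 2 k1 h^3 - 6 k1 h s^2 = 0; the multiplier [6%:R * h * s] of [k1s] removes the
     second term. *)
  apply: (lincomb5_eq0 (- m ^+ 3) (3%:R * m ^+ 2) (- 3%:R * m) 1 (6%:R * h * s)
    E0 E1 E2 E3 k1s).
  by rewrite Dk2 D3; ring.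
move: E4; rewrite Dk2 D3 k10 => E4.
by split; rewrite ?(mulr0, mul0r, oppr0) //; rewrite -[RHS]E4; ring.
Qed.

Lemma free_ccdd a b s u : a != b -> s != u ->
  free [:: curve_vec a; curve_vec b; tangent_vec s; tangent_vec u].
Proof.
have [m [h [-> ->]]] := midpoint two_neq0 a b.
have [s' ->] : exists s', s = m + s' by exists (s - m); rewrite addrC subrK.
have [u' ->] : exists u', u = m + u' by exists (u - m); rewrite addrC subrK.
move: s' u' => {}s {}u ab; rewrite (inj_eq (addrI m)) => su.
have h0 : h != 0 by apply: contraNneq ab => ->; rewrite subr0 addr0.
apply: free_coords5 => k1 k2 k3 k4.
rewrite !mulr1 !mulr0 !addr0 => E0 E1 E2 E3 E4.
have Dk2 : k2 = - k1 by apply/eqP; rewrite -addr_eq0 addrC E0.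
(* [F1] to [F4] are the orders 1 to 4 in X - m, up to nonzero factors. Constant terms are omitted
   from the multipliers because [k1 + k2 = 0]. The curve terms survive only in the odd orders. *)
have F1 : 2%:R * k1 * h + k3 + k4 = 0 by rewrite -[RHS]E1 Dk2; ring.
have F2 : k3 * s + k4 * u = 0.
  apply: (mulIf_eq0 two_neq0).
  by apply: (lincomb2_eq0 (- 2%:R * m) 1 E1 E2); rewrite Dk2; ring.
have F3 : 2%:R * k1 * h ^+ 3 + 3%:R * (k3 * s ^+ 2 + k4 * u ^+ 2) = 0.
  by apply: (lincomb3_eq0 (3%:R * m ^+ 2) (- 3%:R * m) 1 E1 E2 E3);
    rewrite Dk2; ring.
have F4 : k3 * s ^+ 3 + k4 * u ^+ 3 = 0.
  apply: (mulIf_eq0 four_neq0).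
  apply: (lincomb4_eq0 (- 4%:R * m ^+ 3) (6%:R * m ^+ 2) (- 4%:R * m) 1
            E1 E2 E3 E4).
  by rewrite Dk2; ring.
suff k10 : k1 = 0.
  move: F1; rewrite Dk2 k10 oppr0 mulr0 mul0r add0r => F1.
  by have [-> ->] := vandermonde2_eq0 su F1 F2.
have [Dsq|sq_su] := eqVneq (s ^+ 2) (u ^+ 2).
  have {Dsq} Du : u = - s.
    by move/eqP: Dsq; rewrite eqf_sqr (negPf su) => /eqP->; rewrite opprK.
  rewrite {}Du in su F2 F3 {E0 E1 E2 E3 E4 F4}.
  have s0 : s != 0 by apply: contraNneq su => ->; rewrite oppr0.
  have Dk4 : k4 = k3.
    apply/esym/eqP; rewrite -subr_eq0; apply/eqP/(mulIf_eq0 s0).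
    by rewrite -[RHS]F2; ring.
  (* Were this factor zero, 3 would be the square of [h / s]. *)
  have p0 : h ^+ 2 - 3%:R * s ^+ 2 != 0.
    rewrite subr_eq0; apply/eqP => Dh; apply: three_nonsquare; exists (h / s).
    by rewrite expr_div_n Dh mulfK ?expf_neq0.
  have q0 : 2%:R * h * (h ^+ 2 - 3%:R * s ^+ 2) != 0.
    by rewrite !mulf_neq0 ?two_neq0.
  apply: (mulIf_eq0 q0).
  by apply: (lincomb2_eq0 (- 3%:R * s ^+ 2) 1 F1 F3); rewrite Dk4; ring.
(* [F2] and [F4] are a Vandermonde system in [s ^+ 2] and [u ^+ 2] with unknowns [k3 * s] and
   [k4 * u]; order 3 then reduces to 2 k1 h^3 = 0. *)
have [k3s k4u] : k3 * s = 0 /\ k4 * u = 0.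
  by apply: (vandermonde2_eq0 sq_su F2); rewrite -[RHS]F4; ring.
have p0 : 2%:R * h ^+ 3 != 0 by rewrite mulf_neq0 ?expf_neq0 ?two_neq0.
apply: (mulIf_eq0 p0).
by apply: (lincomb3_eq0 1 (- 3%:R * s) (- 3%:R * u) F3 k3s k4u); ring.
Qed.

(** * Arbitrary quadruples, grouped by kind *)

Lemma perm_sort_by_kind (s : seq (option (F + F))) :
  exists (s1 s2 : seq F) n, perm_eq s
    (map (Some \o inl) s1 ++ map (Some \o inr) s2 ++ nseq n None).
Proof.
elim: s => [|i s [s1 [s2 [n IHs]]]]; first by exists [::], [::], 0%N.
case: i => [[t|t]|]; [exists (t :: s1), s2, n|exists s1, (t :: s2), n
  |exists s1, s2, n.+1].
- by rewrite /= perm_cons.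
- rewrite perm_sym /= -(cat1s (Some (inr t)) (map _ s2 ++ _)) perm_catCA.
  by rewrite perm_cons perm_sym.
rewrite perm_sym -[nseq n.+1 None]/([:: None] ++ nseq n None) catA perm_catCA.
by rewrite perm_cons -catA perm_sym.
Qed.

Lemma free_track_vec {s : seq (option (F + F))} :
  uniq s -> size s = 4%N -> free (map track_vec s).
Proof.
have [s1 [s2 [n eq_s]]] := perm_sort_by_kind s.
(* Freeness does not depend on the order of the vectors. *)
rewrite (perm_free (perm_map track_vec eq_s)) (perm_uniq eq_s) (perm_size eq_s).
rewrite !cat_uniq !size_cat !size_map size_nseq.
move=> /and3P[Us1 _ /and3P[Us2 _ Un]].
have {}Us1 : uniq s1 by move: Us1; rewrite map_inj_uniq // => x y [].
have {}Us2 : uniq s2 by move: Us2; rewrite map_inj_uniq // => x y [].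
have {Un} : (n <= 1)%N by case: n Un {eq_s} => [|[|n]].
(* Total size four leaves five types without the point at infinity and four with it. *)
case: n {eq_s} => [|[|//]] _;
  case: s1 Us1 => [|t1 [|t2 [|t3 [|t4 [|? ?]]]]] //;
  case: s2 Us2 => [|u1 [|u2 [|u3 [|u4 [|? ?]]]]] //= U2 U1 // _.
- exact: free_dddd.
- exact: free_cddd.
- by apply: free_ccdd; move: U1 U2; rewrite !inE !andbT.
- exact: free_cccd.
- exact: free_cccc.
- exact: free_ddde.
- by apply: free_cdde; move: U2; rewrite !inE !andbT.
- by apply: free_ccde; move: U1; rewrite !inE !andbT.
- exact: free_ccce.
Qed.

(** * Distinctness of the points *)

Lemma coords5_inj x0 x1 x2 x3 x4 y0 y1 y2 y3 y4 :
  coords5 x0 x1 x2 x3 x4 = coords5 y0 y1 y2 y3 y4 :> 'rV[F]_5 ->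
  [/\ x0 = y0, x1 = y1, x2 = y2, x3 = y3 & x4 = y4].
Proof.
move/rowP => E.
move: (E (@Ordinal 5 0 isT)) (E (@Ordinal 5 1 isT)) (E (@Ordinal 5 2 isT))
  (E (@Ordinal 5 3 isT)) (E (@Ordinal 5 4 isT)).
by rewrite !mxE.
Qed.

Lemma coords5Z k x0 x1 x2 x3 x4 :
  k *: coords5 x0 x1 x2 x3 x4 =
  coords5 (k * x0) (k * x1) (k * x2) (k * x3) (k * x4) :> 'rV[F]_5.
Proof. by apply/rowP=> -[[|[|[|[|[|j]]]]] ltj] //; rewrite !mxE. Qed.

(** The first nonzero coordinate is always 1 and its position gives the kind, so [k = 1]; for curve
    and tangent vectors the next coordinate, [t] or [2%:R * t], gives the parameter. *)
Lemma track_vec_line_inj {i j k} : track_vec i = k *: track_vec j -> i = j.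
Proof.
have nz : (1 : F) <> 0 by apply/eqP; rewrite oner_eq0.
case: i j => [[t|t]|] [[u|u]|] //=;
  rewrite coords5Z ?mulr1 ?mulr0 => /coords5_inj[].
- by move=> <-; rewrite !mul1r => ->.
- by move=> /nz.
- by move=> /nz.
- by move=> <-; rewrite mul0r => /nz.
- by move=> _ <-; rewrite !mul1r => /(mulfI two_neq0) ->.
- by move=> _ /nz.
- by move=> <- _ _ _; rewrite mul0r => /nz.
- by move=> _ <- _ _; rewrite mul0r => /nz.
Qed.

(** * Projective points and the dimension count *)

Lemma track_vec_neq0 i : track_vec i != 0.
Proof.
apply/eqP; have nz : (1 : F) <> 0 by apply/eqP; rewrite oner_eq0.
case: i => [[t|t]|] /= /rowP E.
- by move: (E (@Ordinal 5 0 isT)); rewrite !mxE.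
- by move: (E (@Ordinal 5 1 isT)); rewrite !mxE.
- by move: (E (@Ordinal 5 4 isT)); rewrite !mxE.
Qed.

Lemma track_point_dim i : \dim <[track_vec i]>%VS == 1%N.
Proof. by rewrite dim_vline track_vec_neq0. Qed.

Definition track_point i : proj_space F 4 :=
  exist _ <[track_vec i]>%VS (track_point_dim i).

Lemma track_point_inj : injective track_point.
Proof.
move=> i j /(congr1 val) /= Eij.
have /vlineP[k] : track_vec i \in <[track_vec j]>%VS by rewrite -Eij memv_line.
exact: track_vec_line_inj.
Qed.

Lemma is_track_track_point : is_track (track_point @: setT).
Proof.
move=> A sAS cardA [W [/eqP dimW AW]].
pose I := track_point @^-1: A.
have DA : track_point @: I = A.
  apply/setP => P; apply/imsetP/idP => [[i iI ->]|PA]; first by rewrite inE in iI.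
  have /imsetP[i _ DP] := subsetP sAS P PA.
  by exists i; rewrite // inE -DP.
have cardI : #|I| = 4%N by rewrite -cardA -DA card_imset //; apply: track_point_inj.
have freeI : free (map track_vec (enum I)).
  by apply: free_track_vec; rewrite ?enum_uniq // -cardE.
have : (<<map track_vec (enum I)>> <= W)%VS.
  apply/span_subvP => _ /mapP[i iI ->]; rewrite mem_enum inE in iI.
  by have := AW _ iI; rewrite /lies_on /point_line /= -memvE.
(* Four free vectors would lie in [W], whose linear dimension is 3 as it is a projective plane. *)
by move/dimvS; rewrite (eqP freeI) size_map -cardE cardI dimW.
Qed.

End TrackPoints.

Theorem theorem2p4 (q : nat) (F : finFieldType) (hF : #|F| = q)
    (h3 : ~ exists x : F, x ^+ 2 = 3%:R) :
  let S : {set proj_space F 4} :=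
    [set P | [exists t : F, has_hcoords P (coords5 1 t (t ^+ 2) (t ^+ 3) (t ^+ 4))]]
    :|: [set P | [exists t : F,
          has_hcoords P (coords5 0 1 (2%:R * t) (3%:R * t ^+ 2) (4%:R * t ^+ 3))]]
    :|: [set P | has_hcoords P (coords5 0 0 0 0 1)] in
  is_track S /\ #|S| = (2 * q + 1)%N.
Proof.
(* Both claims concern the image of the injective parametrization by [option (F + F)]. *)
move=> S; have -> : S = @track_point F @: setT.
  apply/setP => P; rewrite !inE; apply/idP/imsetP => [|[i _ ->]].
    case/orP => [/orP[/existsP[t Pt]|/existsP[t Pt]]|Pt].
    - by exists (Some (inl t)); [|exact/eqP].
    - by exists (Some (inr t)); [|exact/eqP].
    - by exists None; [|exact/eqP].
  case: i => [[t|t]|].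
  - by apply/orP; left; apply/orP; left; apply/existsP; exists t; apply: eqxx.
  - by apply/orP; left; apply/orP; right; apply/existsP; exists t; apply: eqxx.
  - by apply/orP; right; apply: eqxx.
split; first exact: is_track_track_point.
rewrite card_imset; last exact: track_point_inj.
by rewrite cardsT card_option card_sum hF mul2n addnn addn1.
Qed.
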